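(* For every integer $n \geq 3$, $$\gamma_{b,2}(P_5 \square C_n) = n + \begin{cases} 0 & \text{if } n \equiv 0 \pmod 2,\\ 1 & \text{if } n \equiv 1 \pmod 2.\end{cases}$$
   Context: For a graph $G$, a $2$-limited broadcast is a function $f: V(G) \to \{0,1,2\}$. A vertex $u$ hears the broadcast from $v$ if $f(v) > 0$ and $d(u,v) \leq f(v)$, where $d$ is the distance in $G$. The broadcast $f$ is dominating if every vertex of $G$ hears the broadcast from some vertex. The cost of $f$ is $\sum_{v \in V(G)} f(v)$. The $2$-limited broadcast domination number $\gamma_{b,2}(G)$ is the minimum cost of a $2$-limited dominating broadcast on $G$. $C_n$ denotes the cycle on $n$ vertices, $P_5$ the path on $5$ vertices, and $\square$ the Cartesian product of graphs. *)

(* Defs.v *)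
From mathcomp Require Import all_boot.
Set Implicit Arguments. Unset Strict Implicit. Unset Printing Implicit Defensive.

Fixpoint within (T : finType) (e : rel T) (k : nat) (u v : T) : bool :=
  match k with
  | 0 => u == v
  | k'.+1 => (u == v) || [exists w, e u w && within e k' w v]
  end.

Definition path_rel (m : nat) : rel 'I_m :=
  fun i j => (i.+1 == j :> nat) || (j.+1 == i :> nat).

Definition cycle_rel (n : nat) : rel 'I_n :=
  fun i j => (j == i.+1 %% n :> nat) || (i == j.+1 %% n :> nat).

Definition cart_rel (A B : finType) (eA : rel A) (eB : rel B) : rel (A * B) :=
  fun x y => (eA x.1 y.1 && (x.2 == y.2)) || ((x.1 == y.1) && eB x.2 y.2).

(* 2-limited broadcasts: f : V -> {0,1,2}. *)
Definition hears (T : finType) (e : rel T) (f : {ffun T -> 'I_3}) (u v : T) :=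
  (0 < f v) && within e (f v) u v.

Definition dominating (T : finType) (e : rel T) (f : {ffun T -> 'I_3}) :=
  [forall u, exists v, hears e f u v].

Definition bcost (T : finType) (f : {ffun T -> 'I_3}) : nat :=
  \sum_(v : T) (f v : nat).

Definition is_gamma_b2 (T : finType) (e : rel T) (g : nat) : Prop :=
  (exists f : {ffun T -> 'I_3}, dominating e f /\ bcost f = g) /\
  (forall f : {ffun T -> 'I_3}, dominating e f -> g <= bcost f).

Arguments is_gamma_b2 : clear implicits.
Definition P5_box_C (n : nat) : rel ('I_5 * 'I_n)%type :=
  cart_rel (@path_rel 5) (@cycle_rel n).
Arguments P5_box_C : clear implicits.

(* Main.v *)
Require Import Defs.
From HB Require Import structures.
From mathcomp Require Import all_boot zify.
Set Implicit Arguments. Unset Strict Implicit. Unset Printing Implicit Defensive.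

(** Lower bound. Unroll the cycle and read a dominating broadcast as an
    [n]-periodic sequence of columns. A finite automaton, whose states record
    which cells near the last column are heard, accepts exactly the sequences
    that dominate. If the cost of a period is at most [n], some starting point
    makes every prefix cost at most its length; under that constraint only
    finitely many pairs (state, length minus cost) are reachable, and the
    difference never exceeds 4. A period of cost less than [n] would make it
    grow without bound. A period of cost exactly [n] is a closed walk of length
    [n] in this finite graph, and the graph has no closed walk of odd length.
    Both facts about the graph are checked by computation.

    Upper bound. A pattern of period 4 and cost 4 is closed up by one of four
    short tails of lengths 3, 4, 5, 6 and costs 4, 4, 6, 6. *)

(** * Parity of closed walks in a finite digraph *)

Section OddClosedWalks.
Variable T : eqType.
Implicit Types (succ : T -> seq T) (l X : seq T).

Definition is_walk succ (y : nat -> T) := forall j, y j.+1 \in succ (y j).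

Definition succ_closed succ X := all (fun x => all (mem X) (succ x)) X.

Fixpoint reach succ fuel seen todo : seq T :=
  if fuel is k.+1 then
    if todo is x :: t then
      if x \in seen then reach succ k seen t
      else reach succ k (x :: seen) (succ x ++ t)
    else seen
  else seen.

Definition prune succ X := [seq x <- X | has (mem X) (succ x)].

(* The vertices reached from [x] in an even number of steps inside [l] must
   have no edge back to [x]; then [x] is deleted. The output of [reach] is
   re-checked by [succ_closed], so nothing has to be proved about [reach]. *)
Fixpoint no_odd fuel succ l : bool :=
  if l is x :: l' then
    let inl y := [seq z <- succ y | z \in l] in
    let two_steps y := flatten [seq inl z | z <- inl y] in
    let E := reach two_steps fuel [::] [:: x] in
    [&& x \in E, succ_closed two_steps E, all (fun y => x \notin succ y) E
      & no_odd fuel succ l']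
  else true.

Lemma closed_walk succ X (y : nat -> T) :
  succ_closed succ X -> is_walk succ y -> y 0 \in X -> forall j, y j \in X.
Proof. by move=> /allP cX wy y0; elim=> // j /cX/allP; apply. Qed.

Lemma prune_walk succ X (y : nat -> T) :
  is_walk succ y -> (forall j, y j \in X) -> forall j, y j \in prune succ X.
Proof.
move=> wy yX j; rewrite mem_filter yX andbT; apply/hasP; exists (y j.+1) => //.
exact: yX.
Qed.

Lemma iter_prune_walk succ X (y : nat -> T) k :
  is_walk succ y -> (forall j, y j \in X) ->
  forall j, y j \in iter k (prune succ) X.
Proof. by move=> wy yX; elim: k => //= k IH; apply: prune_walk. Qed.

(** If the walk meets [x] at time [j], its even steps from there stay in [E]. For odd [n] the vertex
    at time [j + n - 1] is then in [E] and has an edge back to [x], which the check excludes.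
    Otherwise the walk avoids [x] and lives in the rest of the list. *)
Lemma no_oddP fuel succ l n (y : nat -> T) :
  no_odd fuel succ l -> is_walk succ y -> (forall j, y j \in l) ->
  (forall j, y (j + n) = y j) -> ~~ odd n.
Proof.
elim: l => [|x l IH]; first by move=> _ _ /(_ 0).
move=> hno wy yl yn; apply/negP => on.
move: hno; rewrite /=.
set two_steps := fun _ => flatten _; set E := reach _ _ _ _.
case/and4P => xE cE xsucc no_l.
have n0 : 0 < n by rewrite odd_gt0.
(* By periodicity, whether [x] is ever visited is decided on [n] indices. *)
have ymod j : y (j %% n) = y j.
  rewrite [in RHS](divn_eq j n) addnC; elim: (j %/ n) => [|q IHq].
    by rewrite mul0n addn0.
  by rewrite mulSn (addnC n) addnA yn.
case: (boolP [exists j : 'I_n, y j == x]) => [/existsP[j /eqP yj]|].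
  pose z k := y (j + k.*2).
  have wz : is_walk two_steps z.
    move=> k; apply/flattenP; exists [seq u <- succ (y (j + k.*2).+1) | u \in x :: l].
      by apply: (map_f (fun v => filter _ (succ v))); rewrite mem_filter yl wy.
    by rewrite mem_filter yl /z doubleS !addnS wy.
  have zE := closed_walk cE wz.
  have : z n./2 \in E by apply: zE; rewrite /z double0 addn0 yj.
  move/(allP xsucc)/negP; apply.
  have nE : j + n = (j + n./2.*2).+1.
    by have := odd_double_half n; rewrite on; lia.
  by rewrite -{1}yj -yn nE; apply: wy.
rewrite negb_exists => /forallP nyx.
have : ~~ odd n; last by rewrite on.
apply: (IH no_l wy _ yn) => j; move: (yl j).
rewrite inE => /orP[/eqP yj|//].
by move: (nyx (Ordinal (ltn_pmod j n0))); rewrite /= ymod yj eqxx.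
Qed.

End OddClosedWalks.

(** A cycle lemma: start at an [r] maximising [S i - i]. Since [S n <= n], this quantity cannot
    increase from one period to the next, so a maximum over one period is global. *)
Lemma prefix_max_rotation (f : nat -> nat) n :
  0 < n -> (forall i, f (i + n) = f i) -> \sum_(0 <= i < n) f i <= n ->
  exists r, forall k, \sum_(0 <= i < k) f (r + i) <= k.
Proof.
move=> n0 fn; pose S k := \sum_(0 <= i < k) f i.
rewrite -/(S n) => Sn.
have SD a b : S (a + b) = S a + \sum_(0 <= i < b) f (a + i).
  elim: b => [|b IH]; first by rewrite addn0 big_geq // addn0.
  by rewrite addnS /S !big_nat_recr //= -/(S _) IH addnA.
have Sper a : S (n + a) = S n + S a.
  rewrite SD; congr (_ + _); apply: eq_bigr => i _.
  by rewrite addnC fn.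
(* The shift by [n] keeps [S i - i] inside the natural numbers. *)
pose r : 'I_n := [arg max_(i > Ordinal n0) (S i + (n - i))].
have rmax m : m < n -> S m + r <= S r + m.
  move=> mn; rewrite /r; case: arg_maxnP => // i _ /(_ (Ordinal mn) isT) /=.
  have := ltn_ord i; lia.
have rmaxT m : S m + r <= S r + m.
  elim/ltn_ind: m => m IH; case: (ltnP m n) => [/rmax//|nm].
  have := Sper (m - n); rewrite subnKC // => SmE; have := IH (m - n); lia.
exists r => k; have := rmaxT (r + k); rewrite SD; lia.
Qed.

(** * The automaton reading columns *)

Definition mask_or (x y : seq bool) := [seq p.1 || p.2 | p <- zip x y].
Definition mask_diff (x y : seq bool) := [seq p.1 && ~~ p.2 | p <- zip x y].
(** Closed neighbourhood in the path on five vertices. *)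
Definition mask_nbhd (x : seq bool) :=
  mask_or x (mask_or (rcons (behead x) false) (take 5 (false :: x))).

Definition pos_mask (c : seq nat) := [seq 0 < x | x <- c].
Definition two_mask (c : seq nat) := [seq 1 < x | x <- c].

(** A value [x] reaches distance [x - k] inside a column at distance [k]; two columns away only
    [two_mask] is left. *)
Definition cover_self c :=
  mask_or (mask_nbhd (pos_mask c)) (mask_nbhd (mask_nbhd (two_mask c))).
Definition cover_next c := mask_or (pos_mask c) (mask_nbhd (two_mask c)).

(* Masks describing the columns read so far, the last one having index [i]:
   cells of column [i - 1] still unheard, cells of column [i] still unheard,
   cells of column [i + 1] already heard, cells of column [i + 2] already
   heard. *)
Definition state : Type := seq bool * seq bool * seq bool * seq bool.

(* The second component is the number of columns read minus their cost. *)
Definition node : Type := state * nat.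

(* [vm_compute] evaluates both arguments of [&&]; this equality test stops at
   the first difference, which makes the search below twenty times faster. *)
Fixpoint eq_mask (s t : seq bool) : bool :=
  match s, t with
  | b :: s', c :: t' =>
      if b then (if c then eq_mask s' t' else false)
      else (if c then false else eq_mask s' t')
  | [::], [::] => true
  | _, _ => false
  end.

Definition eq_node (x y : node) : bool :=
  let: (p, u, a, d, e) := x in
  let: (p', u', a', d', e') := y in
  if eq_mask u u' then
    if eq_mask p p' then
      if eq_mask a a' then
        if eq_mask d d' then e == e' else false
      else false
    else false
  else false.

Lemma eq_nodeP : Equality.axiom eq_node.
Proof.
have eq_maskE s t : eq_mask s t = (s == t).
  by elim: s t => [|x s IH] [|y t] //=; rewrite eqseq_cons IH; case: x; case: y.
move=> [[[[p u] a] d] e] [[[[p' u'] a'] d'] e']; rewrite /eq_node !eq_maskE.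
apply: (iffP idP); last by case=> -> -> -> -> ->; rewrite !eqxx.
by do 4![case: eqP => // ->]; move/eqP->.
Qed.

HB.instance Definition _ := hasDecEq.Build node eq_nodeP.

(** The column being read is the last one able to reach the cells of [p], and it does so only by a 2
    in the same row. *)
Definition accepts (s : state) c :=
  let: (p, _, _, _) := s in ~~ has id (mask_diff p (two_mask c)).

Definition step (s : state) c : state :=
  let: (_, u, a, d) := s in
  (mask_diff u (cover_next c), map negb (mask_or a (cover_self c)),
   mask_or d (cover_next c), two_mask c).

Fixpoint words m k : seq (seq nat) :=
  if m is m'.+1 then
    flatten [seq map (cons v) (words m' (k - v)) | v <- iota 0 3 & v <= k]
  else [:: [::]].

Lemma mem_words c k :
  all (gtn 3) c -> sumn c <= k -> c \in words (size c) k.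
Proof.
elim: c k => [//|v c IH] k /andP[v3 c3] ck.
rewrite /= in v3 ck; apply/flatten_mapP; exists v.
  by rewrite mem_filter mem_iota; lia.
by apply: map_f; apply: IH => //; lia.
Qed.

(** The bound in [words] keeps each prefix cost at most its length, so the subtraction never
    truncates. *)
Definition succ (x : node) : seq node :=
  [seq (step x.1 c, x.2.+1 - sumn c) | c <- words 5 x.2.+1 & accepts x.1 c].

(** The most permissive start: nothing is pending and the next two columns count as heard, so the
    columns before the start need not be known. *)
Definition full_state : state :=
  (nseq 5 false, nseq 5 false, nseq 5 true, nseq 5 true).

(* Pruning and sorting only speed up [no_odd]. *)
Definition check : bool :=
  let V := reach succ 5000 [::] [:: (full_state, 0) : node] in
  [&& (full_state, 0) \in V, succ_closed succ V, all (fun x => x.2 <= 4) V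
    & no_odd 10000 succ (sort (fun x y => x.2 <= y.2) (iter 6 (prune succ) V))].

Lemma check_true : check.
Proof. by vm_cast_no_check (erefl true). Qed.

Lemma reachable_nodes : exists V : seq node,
  [/\ (full_state, 0) \in V, succ_closed succ V, {in V, forall x, x.2 <= 4}
    & forall n y, is_walk succ y -> (forall j, y j \in V) ->
      (forall j, y (j + n) = y j) -> ~~ odd n].
Proof.
have := check_true; rewrite /check.
move: (reach _ _ _ _) => V /and4P[h1 h2 /(@allP node) h3 h4].
exists V; split=> [//|//|//|n y wy yV].
apply: (no_oddP h4 wy) => j; by rewrite mem_sort; apply: iter_prune_walk.
Qed.

(** * Five-column windows and the lower bound for column sequences *)

Definition dist (a b : nat) := (a - b) + (b - a).

(** The listening cell is in the middle column, of index 2; values are at most 2, so no further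
    columns matter. *)
Definition window_heard (w : seq (seq nat)) (r : nat) :=
  has (fun k => has (fun q => let x := nth 0 (nth [::] w k) q in
    (0 < x) && (dist r q + dist 2 k <= x)) (iota 0 5)) (iota 0 5).

Definition good_window w := all (window_heard w) (iota 0 5).

Definition is_column (c : seq nat) := (size c == 5) && all (gtn 3) c.

Lemma is_columnP c : is_column c ->
  exists x0 x1 x2 x3 x4, c = [:: x0; x1; x2; x3; x4] /\
    [/\ x0 < 3, x1 < 3, x2 < 3, x3 < 3 & x4 < 3].
Proof.
case: c => [|x0 [|x1 [|x2 [|x3 [|x4 [|x5 c]]]]]] //=.
by rewrite /is_column /= andbT => /and5P[]; exists x0, x1, x2, x3, x4.
Qed.

(** The automaton has memory four, so its run on periodic input is itself periodic after four
    columns. *)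
Lemma step4 s s' c0 c1 c2 c3 :
  step (step (step (step s c0) c1) c2) c3 =
  step (step (step (step s' c0) c1) c2) c3.
Proof. by case: s => [[[? ?] ?] ?]; case: s' => [[[? ?] ?] ?]. Qed.

Lemma accepts_good s c0 c1 c2 c3 c4 :
  all is_column [:: c0; c1; c2; c3; c4] ->
  good_window [:: c0; c1; c2; c3; c4] ->
  accepts (step (step (step (step s c0) c1) c2) c3) c4.
Proof.
case/and5P => /is_columnP[a0 [a1 [a2 [a3 [a4 [-> [ha0 ha1 ha2 ha3 ha4]]]]]]].
move=> /is_columnP[b0 [b1 [b2 [b3 [b4 [-> [hb0 hb1 hb2 hb3 hb4]]]]]]].
move=> /is_columnP[d0 [d1 [d2 [d3 [d4 [-> [hd0 hd1 hd2 hd3 hd4]]]]]]].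
move=> /is_columnP[e0 [e1 [e2 [e3 [e4 [-> [he0 he1 he2 he3 he4]]]]]]].
move=> /andP[/is_columnP[g0 [g1 [g2 [g3 [g4 [-> [hg0 hg1 hg2 hg3 hg4]]]]]]] _].
case: s => [[[p u] a] d]; rewrite /good_window.
case/and5P => H0 H1 H2 H3 /andP[H4 _].
rewrite /= !negb_or; apply/and5P; split; last rewrite andbT.
- by move: H0 => {H1 H2 H3 H4}; rewrite /window_heard /dist /=; repeat case/orP; lia.
- by move: H1 => {H0 H2 H3 H4}; rewrite /window_heard /dist /=; repeat case/orP; lia.
- by move: H2 => {H0 H1 H3 H4}; rewrite /window_heard /dist /=; repeat case/orP; lia.
- by move: H3 => {H0 H1 H2 H4}; rewrite /window_heard /dist /=; repeat case/orP; lia.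
- by move: H4 => {H0 H1 H2 H3}; rewrite /window_heard /dist /=; repeat case/orP; lia.
Qed.

Fixpoint run (c : nat -> seq nat) i : state :=
  if i is j.+1 then step (run c j) (c j) else full_state.

Definition run_node (c : nat -> seq nat) i : node :=
  (run c i, i - \sum_(0 <= j < i) sumn (c j)).

Lemma run4 c n i :
  (forall j, c (j + n) = c j) -> run c (i + 4 + n) = run c (i + 4).
Proof.
by move=> cn; rewrite addnAC !addn4 /= -!addSn !cn; apply: step4.
Qed.

Section Walk.
Variable c : nat -> seq nat.
Hypothesis columns : forall i, is_column (c i).
Hypothesis good : forall i, good_window [seq c (i + k) | k <- iota 0 5].
Hypothesis cheap : forall i, \sum_(0 <= j < i) sumn (c j) <= i.

Lemma run_accepts i : accepts (run c i) (c i).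
Proof.
(* The first four tests are passed thanks to [full_state]; every later one sees a whole window. *)
case: (ltnP i 4) => [i4|i4].
  have [a0 [a1 [a2 [a3 [a4 [Ea _]]]]]] := is_columnP (columns 0).
  have [b0 [b1 [b2 [b3 [b4 [Eb _]]]]]] := is_columnP (columns 1).
  have [d0 [d1 [d2 [d3 [d4 [Ed _]]]]]] := is_columnP (columns 2).
  have [e0 [e1 [e2 [e3 [e4 [Ee _]]]]]] := is_columnP (columns 3).
  by case: i i4 => [|[|[|[|]]]] //= _; rewrite ?Ea ?Eb ?Ed ?Ee.
have [j ->] : exists j, i = j.+4 by exists (i - 4); lia.
have := good j; rewrite /= addn0 addn1 addn2 addn3 addn4 => gw.
by apply: (@accepts_good (run c j) _ _ _ _ _ _ gw); rewrite /= !columns.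
Qed.

Lemma run_walk : is_walk succ (run_node c).
Proof.
move=> i; apply/mapP; exists (c i).
  have /andP[/eqP sz c3] := columns i.
  rewrite mem_filter run_accepts -sz; apply: mem_words => //.
  have := cheap i.+1; rewrite big_nat_recr //=.
  by have := cheap i; lia.
rewrite /run_node /=; congr (_, _); rewrite big_nat_recr //=.
by have := cheap i; lia.
Qed.

End Walk.

Lemma window_lower_bound (c : nat -> seq nat) n :
  0 < n -> (forall i, is_column (c i)) ->
  (forall i, good_window [seq c (i + k) | k <- iota 0 5]) ->
  (forall i, c (i + n) = c i) ->
  n + odd n <= \sum_(0 <= i < n) sumn (c i).
Proof.
move=> n0 columns good cn; rewrite leqNgt; apply/negP => lt_cost.
have [||r cheap] := @prefix_max_rotation (fun i => sumn (c i)) n n0.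
- by move=> i; rewrite cn.
- by case: (odd n) lt_cost; lia.
pose b i := c (r + i).
have bn i : b (i + n) = b i by rewrite /b addnA cn.
have bcol i : is_column (b i) by apply: columns.
have bgood i : good_window [seq b (i + k) | k <- iota 0 5].
  by rewrite /b (eq_map (g := fun k => c (r + i + k))) // => k; rewrite addnA.
have wb := run_walk bcol bgood cheap.
have [V [V0 Vclosed Vdebt Vodd]] := reachable_nodes.
have bV := closed_walk Vclosed wb V0.
pose D i := \sum_(0 <= j < i) sumn (b j).
have Dn i : D (i + n) = D i + D n.
  elim: i => [|i IH]; first by rewrite [D 0]big_geq.
  by rewrite addSn /D !big_nat_recr //= -/(D _) -/(D _) IH bn addnAC.
have DnE : D n = \sum_(0 <= i < n) sumn (c i).
  (* Moving the starting point by one column does not change the cost of a period. *)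
  have shift k : \sum_(0 <= i < n) sumn (c (k.+1 + i)) =
                 \sum_(0 <= i < n) sumn (c (k + i)).
    apply/eqP; rewrite -(eqn_add2l (sumn (c (k + 0)))).
    under [X in _ + X == _]eq_bigr => i _ do rewrite addSnnS.
    rewrite -(big_nat_recl n 0 (fun j => sumn (c (k + j)))) //.
    by rewrite big_nat_recr //= cn addn0 addnC.
  by rewrite /D /b; elim: (r) => [//|k IH]; rewrite shift.
rewrite -DnE in lt_cost.
case: (ltnP (D n) n) => [ltn|geq].
  (* Five periods gain at least 5, above the bound 4. *)
  have := Vdebt _ (bV (0 + n + n + n + n + n)); rewrite /= -/(D _) !Dn.
  by rewrite [D 0]big_geq //; lia.
have onn : odd n by case: (odd n) lt_cost geq; lia.
have : ~~ odd n; last by rewrite onn.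
(* The walk is shifted by 4 because the initial states need not recur. *)
apply: (Vodd n (fun j => run_node b (j + 4))) => j; first exact: wb.
  exact: bV.
rewrite addnAC /run_node run4 // -!/(D _) Dn; congr (_, _).
by rewrite onn in lt_cost; lia.
Qed.

(** * From the graph to its columns *)

(** In unrolled coordinates [i] is the leftmost column of the ball and [i + k] its centre, so
    offsets [t] are natural numbers. Balls that wrap around the cycle are included. In the induction
    a step right, vertical or left moves the left end to [i.+2], [i.+1] or [i]. *)
Lemma within_ball n k (r q : 'I_5) (j j' : 'I_n) i :
  j = (i + k) %% n :> nat ->
  reflect (exists2 t, j' = (i + t) %% n :> nat & dist r q + dist k t <= k)
    (within (P5_box_C n) k (r, j) (q, j')).
Proof.
elim: k r j i => [|k IH] r j i jE; apply: (iffP idP).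
- by move=> /eqP[-> <-]; exists 0 => //; rewrite /dist; clear; lia.
- case=> t j't tk; apply/eqP; congr (_, _).
    by apply: val_inj => /=; move: tk; rewrite /dist; clear; lia.
  have t0 : t = 0 by move: tk; rewrite /dist; clear; lia.
  by apply: val_inj; rewrite /= jE j't t0.
- case/orP => [/eqP[<- <-]|/existsP[[r1 j1] /andP[]]].
    by exists k.+1 => //; rewrite /dist; clear; lia.
  rewrite /P5_box_C /cart_rel /= => /orP[/andP[rr /eqP jj]|].
    have j1E : j1 = (i.+1 + k) %% n :> nat by rewrite -jj jE addSnnS.
    case/(IH _ _ _ j1E) => t j't tk; exists t.+1; first by rewrite j't addSnnS.
    by move: rr tk; rewrite /path_rel /dist ; clear; lia.
  case/andP => /eqP <- /orP[] /eqP jj.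
    have j1E : j1 = (i.+2 + k) %% n :> nat.
      by rewrite jj jE -addn1 modnDml; congr (_ %% _); lia.
    case/(IH _ _ _ j1E) => t j't tk; exists t.+2.
      by rewrite j't; congr (_ %% _); lia.
    by move: tk; rewrite /dist; clear; lia.
  have j1E : j1 = (i + k) %% n :> nat.
    have n0 : 0 < n by have := ltn_ord j; lia.
    have : j1 + 1 == i + k + 1 %[mod n].
      by rewrite -addnA !addn1 -jj jE.
    by rewrite eqn_modDr modn_small // => /eqP.
  case/(IH _ _ _ j1E) => t j't tk; exists t => //.
  by move: tk; rewrite /dist; clear; lia.
case=> t j't tk /=; apply/orP.
have n0 : 0 < n by have := ltn_ord j; lia.
(* A shortest path first changes row, then moves along the cycle towards [t]. *)
have [rq|rq] := eqVneq r q; last first.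
  right; pose r1 : 'I_5 := inord (if r < q then r.+1 else r.-1).
  have rqn : (r : nat) != q by apply: contra rq => /eqP/val_inj->.
  have r1E : r1 = (if r < q then r.+1 else r.-1) :> nat.
    by rewrite inordK //; have := ltn_ord q; have := ltn_ord r; case: ifP; clear; lia.
  apply/existsP; exists (r1, j); apply/andP; split.
    rewrite /P5_box_C /cart_rel /= eqxx andbT /path_rel r1E.
    by apply/orP; left; move: rqn; case: ifP; clear; lia.
  have j1E : j = (i.+1 + k) %% n :> nat by rewrite jE addSnnS.
  apply/(IH _ _ _ j1E); exists t.-1; first last.
    by rewrite r1E; move: rqn tk; rewrite /dist; case: ifP; clear; lia.
  by rewrite j't; congr (_ %% _); move: rqn tk; rewrite /dist; clear; lia.
rewrite rq in tk *; case: (ltngtP t k.+1) => tk1.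
- right; pose j1 : 'I_n := Ordinal (ltn_pmod (i + k) n0).
  apply/existsP; exists (q, j1); apply/andP; split.
    rewrite /P5_box_C /cart_rel /= eqxx /cycle_rel /=.
    apply/orP; right; apply/orP; right.
    by rewrite jE -[(_ %% _).+1]addn1 modnDml; apply/eqP; congr (_ %% _); lia.
  have j1E : j1 = (i + k) %% n :> nat by [].
  by apply/(IH _ _ _ j1E); exists t => //; move: tk tk1; rewrite /dist; clear; lia.
- right; pose j1 : 'I_n := Ordinal (ltn_pmod (i.+2 + k) n0).
  apply/existsP; exists (q, j1); apply/andP; split.
    rewrite /P5_box_C /cart_rel /= eqxx /cycle_rel /=.
    apply/orP; right; apply/orP; left.
    by rewrite jE -[(_ %% _).+1]addn1 modnDml; apply/eqP; congr (_ %% _); lia.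
  have j1E : j1 = (i.+2 + k) %% n :> nat by [].
  apply/(IH _ _ _ j1E); exists t.-2; last by move: tk tk1; rewrite /dist; clear; lia.
  by rewrite j't; congr (_ %% _); lia.
- left; apply/eqP; congr (_, _); apply: val_inj.
  by rewrite /= jE j't tk1.
Qed.

Section Columns.
Variable n : nat.
Variable f : {ffun 'I_5 * 'I_n.+1 -> 'I_3}.

Definition column i : seq nat :=
  [seq f (inord r, inord (i %% n.+1)) : nat | r <- iota 0 5].

Lemma column_is_column i : is_column (column i).
Proof. by rewrite /is_column /column /= !ltn_ord. Qed.

Lemma column_periodic i : column (i + n.+1) = column i.
Proof. by rewrite /column modnDr. Qed.

Lemma nth_column i (q : 'I_5) (j : 'I_n.+1) :
  j = i %% n.+1 :> nat -> nth 0 (column i) q = f (q, j).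
Proof.
move=> jE; rewrite /column (nth_map 0) ?size_iota // nth_iota //.
by rewrite add0n -jE !inord_val.
Qed.

Lemma bcost_columns : bcost f = \sum_(0 <= i < n.+1) sumn (column i).
Proof.
rewrite big_mkord /bcost (eq_bigr (fun p => f (p.1, p.2) : nat)); last by case.
rewrite -(pair_bigA _ (fun r j => f (r, j) : nat)) exchange_big.
apply: eq_bigr => j _; rewrite /column sumnE big_map -[iota 0 5]/(index_iota 0 5).
rewrite big_mkord; apply: eq_bigr => r _.
by rewrite modn_small // !inord_val.
Qed.

Lemma hearsP i (r : 'I_5) (j : 'I_n.+1) :
  j = (i + 2) %% n.+1 :> nat ->
  [exists v, hears (P5_box_C n.+1) f (r, j) v] =
  window_heard [seq column (i + k) | k <- iota 0 5] r.
Proof.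
move=> jE; apply/existsP/hasP.
  case=> [[q j']] /andP[f0].
  have f2 : f (q, j') <= 2 by rewrite -ltnS.
  (* A ball of radius less than 2 begins further inside the window. *)
  have jE' : j = (i + (2 - f (q, j')) + f (q, j')) %% n.+1 :> nat.
    by rewrite jE; congr (_ %% _); lia.
  case/(within_ball _ _ _ jE') => t j't tk.
  exists (2 - f (q, j') + t).
    by rewrite mem_iota; move: f0 f2 tk; rewrite /dist; clear; lia.
  apply/hasP; exists (q : nat); first by rewrite mem_iota ltn_ord.
  rewrite (nth_map 0) ?size_iota; last by move: f0 f2 tk; rewrite /dist; clear; lia.
  rewrite nth_iota; last by move: f0 f2 tk; rewrite /dist; clear; lia.
  rewrite add0n (nth_column q (j := j')) ?j't; last by congr (_ %% _); lia.
  rewrite /=; apply/andP; split=> //; move: f0 f2 tk.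
  by move: (nat_of_ord (f _)) => x; rewrite /dist; clear; lia.
case=> k; rewrite mem_iota => /andP[_ k5] /hasP[q].
rewrite mem_iota => /andP[_ q5].
rewrite (nth_map 0) ?size_iota // nth_iota // add0n.
pose j' : 'I_n.+1 := Ordinal (ltn_pmod (i + k) (ltn0Sn n)).
rewrite -[q]/(Ordinal q5 : nat) (nth_column _ (j := j')) // => /andP[f0 fk].
exists (Ordinal q5, j'); rewrite /hears f0 /=.
move: f0 fk; set x := f _ => f0 fk; have x2 : x <= 2 by rewrite -ltnS.
have jE' : j = (i + (2 - x) + x) %% n.+1 :> nat.
  by rewrite jE; congr (_ %% _); lia.
apply/(within_ball _ _ _ jE'); exists (k - (2 - x)).
  by rewrite /=; congr (_ %% _); move: f0 x2 fk; rewrite /dist; clear; lia.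
by move: f0 x2 fk; rewrite /dist /=; clear; lia.
Qed.

Lemma dominating_windows :
  reflect (forall i, good_window [seq column (i + k) | k <- iota 0 5])
    (dominating (P5_box_C n.+1) f).
Proof.
apply: (iffP forallP) => [dom i|good [r j]].
  apply/allP => r; rewrite mem_iota => /= r5.
  rewrite -[r]/(Ordinal r5 : nat).
  by rewrite -(@hearsP i _ (Ordinal (ltn_pmod (i + 2) (ltn0Sn n)))).
(* The window must start at [j - 2]; two periods are added so that the subtraction is exact even for
   one column. *)
rewrite (@hearsP (j + (n.+1 * 2 - 2))).
  by apply: (allP (good _)); rewrite mem_iota ltn_ord.
have -> : j + (n.+1 * 2 - 2) + 2 = j + 2 * n.+1 by lia.
by rewrite addnC modnMDl modn_small.
Qed.

End Columns.

(** * Explicit broadcasts for the upper bound *)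

Definition cyclic_windows (w : seq (seq nat)) i :=
  [seq nth [::] w ((i + k) %% size w) | k <- iota 0 5].

Definition is_cyclic_broadcast w :=
  all is_column w && all (fun i => good_window (cyclic_windows w i))
    (iota 0 (size w)).

Lemma broadcast_of_columns n (w : seq (seq nat)) :
  size w = n.+1 -> is_cyclic_broadcast w ->
  exists f : {ffun 'I_5 * 'I_n.+1 -> 'I_3},
    dominating (P5_box_C n.+1) f /\ bcost f = sumn (map sumn w).
Proof.
move=> sw /andP[/allP colw /allP goodw].
have colj j : j < n.+1 -> is_column (nth [::] w j).
  by move=> jn; apply: colw; rewrite mem_nth ?sw.
pose f := [ffun p : 'I_5 * 'I_n.+1 => inord (nth 0 (nth [::] w p.2) p.1) : 'I_3].
have columnE i : column f i = nth [::] w (i %% n.+1).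
  have jn : i %% n.+1 < n.+1 by rewrite ltn_pmod.
  have /andP[/eqP s5 /allP c3] := colj _ jn.
  apply: (@eq_from_nth _ 0) => [|r]; first by rewrite size_map s5.
  rewrite size_map size_iota => r5.
  rewrite (nth_map 0) ?size_iota // nth_iota // add0n ffunE /= !inordK //.
  by apply: (c3 (nth 0 (nth [::] w (i %% n.+1)) r)); rewrite mem_nth ?s5.
exists f; split.
  apply/dominating_windows => i.
  have := goodw (i %% n.+1); rewrite mem_iota add0n sw ltn_pmod // => /(_ isT).
  congr good_window; rewrite /cyclic_windows; apply: eq_map => k.
  by rewrite columnE sw modnDml.
rewrite bcost_columns sumnE big_map (big_nth [::]) sw.
by apply: eq_big_nat => i /andP[_ ilt]; rewrite columnE modn_small.
Qed.

(** Windows of a linear list, defined by recursion so that it computes on a concrete prefix with an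
    unknown rest. *)
Fixpoint chain (l : seq (seq nat)) : bool :=
  if l is _ :: l' then ((size l < 5) || good_window (take 5 l)) && chain l'
  else true.

Lemma chainP l i :
  chain l -> i + 4 < size l ->
  good_window [seq nth [::] l (i + k) | k <- iota 0 5].
Proof.
elim: i l => [|i IH] [|a l] // /andP[gw cl] il; last exact: IH.
by move: gw; rewrite ltnNge il -(map_nth_iota0 [::]).
Qed.

(** Repeating the first four columns at the end turns every cyclic window into a linear one. *)
Lemma cyclic_broadcast_chain w :
  3 < size w -> all is_column w -> chain (w ++ take 4 w) ->
  is_cyclic_broadcast w.
Proof.
move=> w4 colw cw; rewrite /is_cyclic_broadcast colw; apply/allP => i.
rewrite mem_iota => /= iw.
have size4 : size (take 4 w) = 4 by rewrite size_takel.
have := chainP (i := i) cw; rewrite size_cat size4 ltn_add2r => /(_ iw).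
congr good_window; apply/eq_in_map => k; rewrite mem_iota => /= k5.
rewrite nth_cat; case: ltnP => ikw; first by rewrite modn_small.
rewrite nth_take; last by lia.
have -> : (i + k) %% size w = (i + k - size w) %% size w.
  by rewrite -{1}(subnK ikw) modnDr.
by rewrite modn_small //; lia.
Qed.

(** Each 2 covers its own column and the middle three cells of both adjacent columns; the border 1s
    and the middle-row 2s cover the rest. *)
Definition period : seq (seq nat) :=
  [:: [:: 0; 0; 0; 0; 0]; [:: 1; 0; 0; 0; 1];
      [:: 0; 0; 0; 0; 0]; [:: 0; 0; 2; 0; 0]].

(** Entry [r] has length [r + 3], so that [n = 3] is a tail alone. *)
Definition tail (r : 'I_4) : seq (seq nat) :=
  nth [::]
    [:: [:: [:: 0; 0; 0; 0; 0]; [:: 1; 0; 0; 0; 1]; [:: 0; 0; 2; 0; 0]];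
        period;
        period ++ [:: [:: 0; 0; 2; 0; 0]];
        [:: [:: 0; 0; 0; 0; 0]; [:: 0; 0; 0; 0; 0]; [:: 2; 0; 0; 0; 2];
            [:: 0; 0; 0; 0; 0]; [:: 0; 0; 0; 0; 0]; [:: 0; 0; 2; 0; 0]]] r.

Fixpoint pattern k r : seq (seq nat) :=
  if k is k'.+1 then period ++ pattern k' r else tail r.

Lemma size_pattern k r : size (pattern k r) = 4 * k + r + 3.
Proof.
elim: k => [|k IH] /=; last by rewrite IH; lia.
by case: r => [[|[|[|[|]]]]].
Qed.

Lemma cost_pattern k r :
  sumn (map sumn (pattern k r)) = 4 * k + r + 3 + ~~ odd r.
Proof.
elim: k => [|k IH] /=; last by rewrite IH; lia.
by case: r => [[|[|[|[|]]]]].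
Qed.

(** The four windows starting in the first period lie inside the two periods, so they are evaluated
    whatever [y] is. *)
Lemma chain_period y : chain (period ++ period ++ y) = chain (period ++ y).
Proof. by []. Qed.

Lemma pattern_broadcast k r : is_cyclic_broadcast (pattern k r).
Proof.
(* A lone tail may have only three columns and is checked directly; longer patterns begin with
   [period], which is what wraps around. *)
case: k => [|k]; first by case: r => [[|[|[|[|]]]]] // ?; vm_compute.
apply: cyclic_broadcast_chain.
- by rewrite size_pattern; lia.
- elim: k => [|k IH]; last by rewrite [pattern _ _]/= /= in IH *.
  by case: r => [[|[|[|[|]]]]] // ?; vm_compute.
- have -> : take 4 (pattern k.+1 r) = period by rewrite /= take0.
  elim: k => [|k IH].
    by case: r => [[|[|[|[|]]]]] // ?; vm_compute.
  rewrite -[pattern _ _ ++ _]/(period ++ period ++ (pattern k r ++ period)).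
  by rewrite chain_period.
Qed.

Theorem theorem4p11 (n : nat) : 3 <= n ->
  is_gamma_b2 _ (P5_box_C n) (n + (if odd n then 1 else 0)).
Proof.
case: n => // n n3; split.
  pose r : 'I_4 := inord ((n.+1 - 3) %% 4).
  pose k := (n.+1 - 3) %/ 4.
  have rE : r = (n.+1 - 3) %% 4 :> nat by rewrite inordK ?ltn_pmod.
  have nE : n.+1 = 4 * k + r + 3.
    by rewrite rE /k; have := divn_eq (n.+1 - 3) 4; lia.
  have [|f [domf costf]] :=
    broadcast_of_columns (n := n) _ (pattern_broadcast k r).
    by rewrite size_pattern.
  have odd_n : odd n.+1 = ~~ odd r by rewrite nE oddD (oddD (4 * k)) oddM addbT.
  exists f; split=> //; rewrite costf cost_pattern -nE odd_n.
  by case: (odd r).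
move=> f /dominating_windows good.
rewrite bcost_columns.
have -> : (if odd n.+1 then 1 else 0) = odd n.+1 by case: odd.
apply: window_lower_bound => //; first exact: column_is_column.
exact: column_periodic.
Qed.
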